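(* Consider a solution of a mirror system of four particles (as defined in the context), and let $\kappa=-2E_2^0/\sigma_1^0$. If $\Delta\ge-\mathcal{E}^2$ and the $n$-th collision (between particles 1 and 2) is tachyonic, then $$\frac{x_1^n}{x_1^0}\le \frac{4\kappa\,\mathcal{E}^2}{\mu}.$$
   Context: Units are such that the speed of light is $1$. A particle on the real line has energy $E\in\mathbb{R}\setminus\{0\}$, momentum $P\in\mathbb{R}$, velocity $v=P/E$ and squared mass $E^2-P^2$; energies may have either sign. For each particle put $\sigma=E+P$ and $\rho=E-P$. Between collisions particles move with constant velocity. When particles $i,j$ with $v_i\ne v_j$ collide, put $s=\sigma_i+\sigma_j$, $r=\rho_i+\rho_j$; provided $sr\neq0$, the post-collision values are $\sigma_i'=\rho_i s/r$, $\rho_i'=\sigma_i r/s$, $\sigma_j'=\rho_j s/r$, $\rho_j'=\sigma_j r/s$ (total energy, total momentum and each squared mass are preserved). The collision is called tachyonic if $sr=(E_i+E_j)^2-(P_i+P_j)^2<0$. A mirror system consists of four particles with positions $x_1\le x_2\le x_3\le x_4$ such that at all times $x_1=-x_4$, $x_2=-x_3$, $E_1=E_4$, $P_1=-P_4$, $E_2=E_3$, $P_2=-P_3$; the squared masses are $\mu_1=\mu_4=\mu>0$ and $\mu_2=\mu_3=0$. Collisions of the pair 1-2 are simultaneous with those of the pair 3-4; particles 2 and 3 collide only at the origin, where they exchange their energies and momenta (so $E_2$ is unchanged and $P_2$ changes sign). The quantity $\mathcal{E}=E_1+E_2$ is a constant of the motion, and $\Delta=\mathcal{E}^2-\mu$.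 Solutions are assumed to be such that every collision, in the future and in the past, can be resolved by the collision rule $\sigma_i'=\rho_i s/r$, $\rho_i'=\sigma_i r/s$, $\sigma_j'=\rho_j s/r$, $\rho_j'=\sigma_j r/s$ ($sr\ne0$), and there are no multiple collisions at the same time and point (in particular $x_1<0$). The collisions between particles 1 and 2 (equivalently 3 and 4) are indexed in time order by $n\in\mathbb{Z}$: $x_1^n$ is the position of particle $1$ at the $n$-th such collision; $E_j^n$, $P_j^n$ are the energy and momentum of particle $j$ between the $n$-th and the $(n+1)$-th such collisions ($E_1$, $P_1$ and $E_2$ are constant there), and $\sigma_1^n=E_1^n+P_1^n$. *)

(* Defs.v *)
From Stdlib Require Import Reals ZArith.
Open Scope R_scope.
Set Implicit Arguments.

Record enmom := EnMom { en : R; mo : R }.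

Definition vel (q : enmom) : R := mo q / en q.
Definition mass2 (q : enmom) : R := (en q)^2 - (mo q)^2.
Definition sigma_of (q : enmom) : R := en q + mo q.
Definition rho_of (q : enmom) : R := en q - mo q.

Definition pair_s (qi qj : enmom) : R := sigma_of qi + sigma_of qj.
Definition pair_r (qi qj : enmom) : R := rho_of qi + rho_of qj.

(* Primed arguments are the post-collision values. *)
Definition collision_rule (qi qj qi' qj' : enmom) : Prop :=
  let s := pair_s qi qj in
  let r := pair_r qi qj in
  vel qi <> vel qj /\ s * r <> 0 /\
  sigma_of qi' = rho_of qi * s / r /\ rho_of qi' = sigma_of qi * r / s /\
  sigma_of qj' = rho_of qj * s / r /\ rho_of qj' = sigma_of qj * r / s.

(* Positions and energy-momenta as functions of time.  Energy-momentum jumps at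
   collisions; by convention [state m i t] is right-continuous, i.e. at a
   collision time it is the post-collision value. *)
Record motion (I : Type) := Motion {
  pos : I -> R -> R;
  state : I -> R -> enmom
}.

(* The value of the energy-momentum of particle i just before time t. *)
Definition incoming I (m : motion I) (i : I) (t : R) (q : enmom) : Prop :=
  exists d, 0 < d /\ forall s, t - d < s < t -> state m i s = q.

Definition collide I (m : motion I) (i j : I) (t : R) : Prop :=
  i <> j /\ pos m i t = pos m j t.

(* The isolation clause makes "between collisions" meaningful; together with the
   free-motion clause it implies that the positions are continuous. *)
Record solution I (m : motion I) : Prop := {
  energy_neq0 : forall i t, en (state m i t) <> 0;
  collisions_isolated : forall t, exists d, 0 < d /\
    forall s, 0 < Rabs (s - t) < d -> forall i j, ~ collide m i j s;
  free_motion : forall i a b, a < b ->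
    (forall s, a < s < b -> forall j, ~ collide m i j s) ->
    (forall s, a <= s < b -> state m i s = state m i a) /\
    (forall s, a <= s <= b ->
       pos m i s = pos m i a + vel (state m i a) * (s - a));
  collisions_resolved : forall i j t, collide m i j t ->
    exists qi qj, incoming m i t qi /\ incoming m j t qj /\
      collision_rule qi qj (state m i t) (state m j t);
  no_multiple_collision : forall i j k t,
    i <> k -> collide m i j t -> ~ collide m j k t
}.

Definition tachyonic I (m : motion I) (i j : I) (t : R) : Prop :=
  collide m i j t /\
  exists qi qj, incoming m i t qi /\ incoming m j t qj /\
    pair_s qi qj * pair_r qi qj < 0.

Inductive particle := p1 | p2 | p3 | p4.

(* That particles 2 and 3 meet at the origin and there exchange their
   energy-momenta follows from the symmetry and [collision_rule]. *)
Record mirror_system (mu : R) (m : motion particle) : Prop := {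
  mirror_solution : solution m;
  mirror_order : forall t,
    pos m p1 t <= pos m p2 t <= pos m p3 t /\ pos m p3 t <= pos m p4 t;
  mirror_pos : forall t,
    pos m p1 t = - pos m p4 t /\ pos m p2 t = - pos m p3 t;
  mirror_en : forall t,
    en (state m p1 t) = en (state m p4 t) /\
    en (state m p2 t) = en (state m p3 t);
  mirror_mo : forall t,
    mo (state m p1 t) = - mo (state m p4 t) /\
    mo (state m p2 t) = - mo (state m p3 t);
  mirror_mu_gt0 : 0 < mu;
  mirror_mass_outer : forall t,
    mass2 (state m p1 t) = mu /\ mass2 (state m p4 t) = mu;
  mirror_mass_inner : forall t,
    mass2 (state m p2 t) = 0 /\ mass2 (state m p3 t) = 0
}.

(* T enumerates, in time order, exactly the collisions of particles 1 and 2. *)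
Definition collision_times12 (m : motion particle) (T : Z -> R) : Prop :=
  (forall n : Z, T n < T (n + 1)%Z) /\
  (forall t, collide m p1 p2 t <-> exists n : Z, t = T n).

Definition x1_at (m : motion particle) (T : Z -> R) (n : Z) : R :=
  pos m p1 (T n).

(* Energy-momentum of particle i after the n-th 1-2 collision.  It persists up to
   the next one, except that the momentum of particle 2 changes sign at the
   origin. *)
Definition state_after (m : motion particle) (T : Z -> R) (i : particle) (n : Z)
  : enmom := state m i (T n).

(* E_1 + E_2, a constant of the motion, evaluated after collision 0. *)
Definition calE (m : motion particle) (T : Z -> R) : R :=
  en (state_after m T p1 0) + en (state_after m T p2 0).

Definition mirror_Delta (mu : R) (m : motion particle) (T : Z -> R) : R :=
  (calE m T)^2 - mu.

Definition kappa (m : motion particle) (T : Z -> R) : R :=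
  - 2 * en (state_after m T p2 0) / sigma_of (state_after m T p1 0).

(* Main.v *)
From Stdlib Require Import Reals ZArith Lra Lia Classical.
Require Import Defs.
Open Scope R_scope.
Set Implicit Arguments.

(** Write [x_n] for the position of particle 1 at the n-th 1-2 collision and
    [kappa_n = - 2 E_2^n / sigma_1^n].  The light-like particle 2 leaves that
    collision with velocity 1, is reflected exactly once at the origin, and comes
    back with velocity -1; hence [x_{n+1} = x_n rho_1^n / sigma_1^n], while the
    collision rule gives [kappa_{n+1} = kappa_n sigma_1^n / rho_1^n].  So
    [x_n kappa_n] does not depend on n.  The collision rule preserves s and r, and
    after the collision [s r = sigma_1 rho_1 (1 - kappa_n) = mu (1 - kappa_n)];
    thus the n-th collision is tachyonic iff [kappa_n > 1], and then
    [x_n / x_0 = kappa_0 / kappa_n < kappa_0].  The bound follows because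
    [Delta >= - calE^2] means [2 calE^2 >= mu]. *)

(** * Isolated events in time *)

(** Isolation excludes accumulation, both at [a] and at the infimum of the occurrences, so that
    infimum is attained. It is built as the supremum of the end points of event-free intervals
    starting at [a]. *)
Lemma first_occurrence (P : R -> Prop) (a b : R) :
  (forall t, exists d, 0 < d /\ forall s, 0 < Rabs (s - t) < d -> ~ P s) ->
  a < b -> P b ->
  exists c, a < c <= b /\ P c /\ forall s, a < s < c -> ~ P s.
Proof.
intros iso ab Pb.
set (S := fun s => s <= b /\ forall u, a < u < s -> ~ P u).
destruct (completeness S) as [c [ub lub]].
- exists b; intros s [sb _]; exact sb.
- exists a; split; [lra | intros u; lra].
- assert (cb : c <= b) by (apply lub; intros s [sb _]; exact sb).
  assert (free : forall u, a < u < c -> ~ P u).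
  { intros u [au uc] Pu.
    assert (c <= u); [|lra].
    apply lub; intros s [_ Ss].
    destruct (Rle_lt_dec s u) as [|us]; [assumption|].
    exfalso; exact (Ss u (conj au us) Pu). }
  assert (ac : a < c).
  { destruct (iso a) as [d [d0 Hd]].
    assert (S (Rmin b (a + d / 2))).
    { split; [apply Rmin_l|].
      intros u [au ub']; apply Hd.
      generalize (Rmin_r b (a + d / 2)); intros.
      rewrite Rabs_pos_eq; lra. }
    apply Rlt_le_trans with (Rmin b (a + d / 2)); [|now apply ub].
    apply Rmin_glb_lt; lra. }
  exists c; split; [lra|]; split; [|exact free].
  apply NNPP; intros nPc.
  destruct (Req_dec c b) as [->|cnb]; [tauto|].
  destruct (iso c) as [d [d0 Hd]].
  (* If [P] failed at [c < b], isolation at [c] would prolong the event-free interval beyond [c],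
     against the choice of [c] as an upper bound. *)
  assert (Sc : S (Rmin b (c + d / 2))).
  { split; [apply Rmin_l|].
    intros u [au ub'].
    generalize (Rmin_r b (c + d / 2)); intros.
    destruct (Rtotal_order u c) as [uc|[->|cu]]; [now apply free; split|exact nPc|].
    apply Hd; rewrite Rabs_pos_eq; lra. }
  apply ub in Sc.
  assert (c < Rmin b (c + d / 2)) by (apply Rmin_glb_lt; lra).
  lra.
Qed.

(** * Velocities determined by the squared mass *)

Lemma massive_subluminal (q : enmom) :
  en q <> 0 -> 0 < mass2 q -> -1 < vel q < 1.
Proof.
unfold mass2, vel; intros e0 m0.
assert (eq : mo q = mo q / en q * en q) by (field; exact e0).
set (v := mo q / en q) in *.
rewrite eq in m0.
assert (0 < en q ^ 2) by (rewrite <- Rsqr_pow2; exact (Rsqr_pos_lt _ e0)).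
assert (v ^ 2 < 1) by nra.
split; nra.
Qed.

Lemma massless_luminal (q : enmom) :
  en q <> 0 -> mass2 q = 0 ->
  (vel q = 1 /\ mo q = en q) \/ (vel q = -1 /\ mo q = - en q).
Proof.
unfold mass2, vel; intros e0 m0.
assert (H : (en q - mo q) * (en q + mo q) = 0) by lra.
apply Rmult_integral in H; destruct H as [H|H]; [left|right].
- replace (mo q) with (en q) by lra; split; [now field|reflexivity].
- replace (mo q) with (- en q) by lra; split; [now field|reflexivity].
Qed.

(** * States just before a collision *)

Lemma collide_sym (I : Type) (m : motion I) (i j : I) (t : R) :
  collide m i j t -> collide m j i t.
Proof. intros [ij e]; split; [now apply not_eq_sym|now symmetry]. Qed.

(** Replaces two left limits by the states at one earlier time, from which [free_motion] and the
    mirror symmetries can be applied. *)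
Lemma incoming_witness (I : Type) (m : motion I) (i j : I) (t : R) (qi qj : enmom) :
  solution m -> incoming m i t qi -> incoming m j t qj ->
  exists a, a < t /\ state m i a = qi /\ state m j a = qj /\
    forall s, a < s < t -> forall k l, ~ collide m k l s.
Proof.
intros hs [d1 [d1p H1]] [d2 [d2p H2]].
destruct (collisions_isolated hs t) as [d [dp Hd]].
set (e := Rmin d (Rmin d1 d2)).
assert (e <= d /\ e <= d1 /\ e <= d2) as [ed [ed1 ed2]].
{ unfold e; generalize (Rmin_l d (Rmin d1 d2)) (Rmin_r d (Rmin d1 d2))
    (Rmin_l d1 d2) (Rmin_r d1 d2); lra. }
assert (0 < e) by (unfold e; repeat apply Rmin_glb_lt; assumption).
exists (t - e / 2); split; [lra|]; split; [apply H1; lra|]; split; [apply H2; lra|].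
intros s hs' k l; apply Hd.
rewrite Rabs_left; lra.
Qed.

Lemma incoming_unique (I : Type) (m : motion I) (i : I) (t : R) (q q' : enmom) :
  solution m -> incoming m i t q -> incoming m i t q' -> q = q'.
Proof.
intros hs h h'.
destruct (incoming_witness hs h h') as [a [_ [e [e' _]]]]; congruence.
Qed.

Lemma free_incoming (I : Type) (m : motion I) (i : I) (a b : R) :
  solution m -> a < b ->
  (forall s, a < s < b -> forall j, ~ collide m i j s) ->
  incoming m i b (state m i a).
Proof.
intros hs ab free; exists (b - a); split; [lra|].
intros s hs'; apply (proj1 (free_motion hs ab free)); lra.
Qed.

(** Both trajectories are straight just before they meet at [t]; the one starting on the left cannot
    be the slower. *)
Lemma collide_approach (I : Type) (m : motion I) (i j : I) (t : R) (qi qj : enmom) :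
  solution m -> (forall s, pos m i s <= pos m j s) ->
  collide m i j t -> incoming m i t qi -> incoming m j t qj ->
  vel qi <> vel qj -> vel qj < vel qi.
Proof.
intros hs le [_ e] hi hj ne.
destruct (incoming_witness hs hi hj) as [a [at_ [ei [ej free]]]].
destruct (free_motion hs (i := i) at_ (fun s h => free s h i)) as [_ Hi].
destruct (free_motion hs (i := j) at_ (fun s h => free s h j)) as [_ Hj].
specialize (Hi t ltac:(lra)); specialize (Hj t ltac:(lra)).
rewrite ei in Hi; rewrite ej in Hj.
specialize (le a).
assert (vel qj <= vel qi) by nra.
lra.
Qed.

(** * Which collisions occur, and where *)

Lemma collision_times12_lt (m : motion particle) (T : Z -> R) (k l : Z) :
  collision_times12 m T -> (k < l)%Z -> T k < T l.
Proof.
intros [inc _] kl.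
replace l with (k + Z.of_nat (S (Z.to_nat (l - k - 1))))%Z by lia.
generalize (Z.to_nat (l - k - 1)); intros d.
induction d as [|d IH]; [apply inc|].
apply Rlt_trans with (1 := IH).
replace (k + Z.of_nat (S (S d)))%Z with (k + Z.of_nat (S d) + 1)%Z by lia.
apply inc.
Qed.

Lemma no_collision12_between (m : motion particle) (T : Z -> R) (n : Z) (t : R) :
  collision_times12 m T -> T n < t < T (n + 1)%Z -> ~ collide m p1 p2 t.
Proof.
intros hT ht c.
destruct (proj1 (proj2 hT t) c) as [k ->].
destruct (Z.lt_trichotomy k n) as [kn|[->|nk]]; [|lra|].
- generalize (collision_times12_lt hT kn); lra.
- destruct (Z.eq_dec k (n + 1)) as [->|ne]; [lra|].
  assert (H : (n + 1 < k)%Z) by lia.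
  generalize (collision_times12_lt hT H); lra.
Qed.

(** By the ordering, particle 2 is squeezed between particle 1 and whichever particle it meets. *)
Lemma mirror_collide_p1 (mu : R) (m : motion particle) (j : particle) (t : R) :
  mirror_system mu m -> collide m p1 j t -> collide m p1 p2 t.
Proof.
intros hm [ne e]; split; [discriminate|].
generalize (mirror_order hm t); destruct j; [congruence|lra..].
Qed.

Lemma mirror_collide_p2 (mu : R) (m : motion particle) (j : particle) (t : R) :
  mirror_system mu m -> collide m p2 j t ->
  collide m p1 p2 t \/ collide m p2 p3 t.
Proof.
intros hm [ne e].
generalize (mirror_order hm t); intros o.
destruct j; [left|congruence|right|right]; split; try discriminate; lra.
Qed.

(** Since [x1 <= x2 <= - x2], a collision at a position [>= 0] would happen at the origin and also
    involve particle 3. *)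
Lemma collide12_pos_lt0 (mu : R) (m : motion particle) (t : R) :
  mirror_system mu m -> collide m p1 p2 t -> pos m p1 t < 0.
Proof.
intros hm c.
generalize (mirror_order hm t) (mirror_pos hm t); intros o p.
destruct (Rlt_le_dec (pos m p1 t) 0) as [|ge]; [assumption|].
exfalso.
assert (c23 : collide m p2 p3 t) by (split; [discriminate|lra]).
assert (ne : p1 <> p3) by discriminate.
exact (no_multiple_collision (mirror_solution hm) ne c c23).
Qed.

(** * Outcome of 1-2 and 2-3 collisions *)

(** Particle 1 is slower than light and approaches from the left, so particle 2 arrives with
    velocity -1, that is with [sigma = 0]. The rule makes the new [rho] a multiple of the old
    [sigma], hence zero. *)
Lemma collide12_outgoing (mu : R) (m : motion particle) (t : R) :
  mirror_system mu m -> collide m p1 p2 t ->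
  vel (state m p2 t) = 1 /\ mo (state m p2 t) = en (state m p2 t).
Proof.
intros hm c.
assert (hs := mirror_solution hm).
destruct (collisions_resolved hs c) as [q1 [q2 [h1 [h2 [ne [sr0 [_ [_ [_ r2]]]]]]]]].
assert (v := collide_approach hs (fun s => proj1 (proj1 (mirror_order hm s)))
  c h1 h2 ne).
destruct (incoming_witness hs h1 h2) as [a [_ [e1 [e2 _]]]].
assert (v1 : -1 < vel q1 < 1).
{ apply massive_subluminal; rewrite <- e1.
  - apply (energy_neq0 hs).
  - rewrite (proj1 (mirror_mass_outer hm a)); exact (mirror_mu_gt0 hm). }
assert (p2' : mo q2 = - en q2).
{ destruct (massless_luminal (q := q2)) as [[H _]|[_ H]]; [..|exact H].
  - rewrite <- e2; apply (energy_neq0 hs).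
  - rewrite <- e2; apply (mirror_mass_inner hm).
  - lra. }
assert (eq : mo (state m p2 t) = en (state m p2 t)).
{ assert (rho_of (state m p2 t) = 0).
  { rewrite r2; unfold sigma_of; rewrite p2'; unfold Rdiv; ring. }
  unfold rho_of in *; lra. }
split; [|exact eq].
unfold vel; rewrite eq; field; apply (energy_neq0 hs).
Qed.

(** Symmetry gives opposite velocities, so approach forces particle 2 to arrive with velocity 1.
    Here [s = r = 2 * en q], and the rule merely swaps [sigma] and [rho]. *)
Lemma collide23_outgoing (mu : R) (m : motion particle) (t : R) (q : enmom) :
  mirror_system mu m -> collide m p2 p3 t -> incoming m p2 t q ->
  en (state m p2 t) = en q /\ mo (state m p2 t) = - en q /\
  vel (state m p2 t) = -1.
Proof.
intros hm c hq.
assert (hs := mirror_solution hm).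
destruct (collisions_resolved hs c) as [q2 [q3 [h2 [h3 [ne [sr0 [s2 [r2 _]]]]]]]].
rewrite (incoming_unique hs hq h2) in *; clear q hq.
assert (v := collide_approach hs (fun s => proj2 (proj1 (mirror_order hm s)))
  c h2 h3 ne).
destruct (incoming_witness hs h2 h3) as [a [_ [e2 [e3 _]]]].
assert (en23 := proj2 (mirror_en hm a)).
assert (mo23 := proj2 (mirror_mo hm a)).
assert (e0 := energy_neq0 hs p2 a).
assert (m0 := proj1 (mirror_mass_inner hm a)).
rewrite e2 in *; rewrite e3 in *.
assert (v3 : vel q3 = - vel q2).
{ unfold vel; rewrite <- en23; replace (mo q3) with (- mo q2) by lra.
  field; exact e0. }
assert (p2' : mo q2 = en q2).
{ destruct (massless_luminal e0 m0) as [[_ H]|[H _]]; [exact H|lra]. }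
assert (eqs : pair_s q2 q3 = 2 * en q2) by (unfold pair_s, sigma_of; lra).
assert (eqr : pair_r q2 q3 = 2 * en q2) by (unfold pair_r, rho_of; lra).
rewrite eqs, eqr in *.
assert (s2' : sigma_of (state m p2 t) = rho_of q2) by (rewrite s2; field; exact e0).
assert (r2' : rho_of (state m p2 t) = sigma_of q2) by (rewrite r2; field; exact e0).
unfold sigma_of, rho_of in s2', r2'.
assert (en (state m p2 t) = en q2 /\ mo (state m p2 t) = - en q2) as [ee mm] by lra.
split; [exact ee|]; split; [exact mm|].
unfold vel; rewrite ee, mm; field; exact e0.
Qed.

(** * Reflection of particle 2 between consecutive 1-2 collisions *)

Lemma mirror_reflection (mu : R) (m : motion particle) (T : Z -> R) (n : Z) :
  mirror_system mu m -> collision_times12 m T ->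
  exists q, incoming m p2 (T (n + 1)%Z) q /\
    en q = en (state m p2 (T n)) /\ mo q = - en (state m p2 (T n)) /\
    pos m p2 (T (n + 1)%Z) =
      - pos m p2 (T n) - (T (n + 1)%Z - T n).
Proof.
intros hm hT.
assert (hs := mirror_solution hm).
assert (ab := proj1 hT n).
assert (no12 := fun t => no_collision12_between n (t := t) hT).
assert (ca : collide m p1 p2 (T n)) by (apply (proj2 hT); exists n; reflexivity).
assert (cb : collide m p1 p2 (T (n + 1)%Z)).
{ apply (proj2 hT); exists (n + 1)%Z; reflexivity. }
set (a := T n) in *; set (b := T (n + 1)%Z) in *.
assert (free2 : forall u w, a <= u -> w <= b ->
  (forall s, u < s < w -> ~ collide m p2 p3 s) ->
  forall s, u < s < w -> forall j, ~ collide m p2 j s).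
{ intros u w au wb no s hs' j cj.
  destruct (mirror_collide_p2 hm cj) as [c|c];
    [apply (no12 s); [lra|exact c]|exact (no s hs' c)]. }
assert (iso : forall t, exists d, 0 < d /\
  forall s, 0 < Rabs (s - t) < d -> ~ collide m p2 p3 s).
{ intros t; destruct (collisions_isolated hs t) as [d [d0 Hd]].
  exists d; split; [exact d0|]; intros s h; exact (Hd s h p2 p3). }
destruct (collide12_outgoing hm ca) as [va _].
(* Without a reflection, particle 2 would run ahead at speed 1 and the slower particle 1 could not
   meet it at [b]. *)
assert (exists c, a < c < b /\ collide m p2 p3 c) as [c0 [hc0 cc0]].
{ apply NNPP; intros none.
  assert (no : forall s, a < s < b -> ~ collide m p2 p3 s).
  { intros s hs' c; apply none; exists s; split; assumption. }
  destruct (free_motion hs (i := p2) ab (free2 a b (Rle_refl a) (Rle_refl b) no))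
    as [_ H2].
  assert (free1 : forall s, a < s < b -> forall j, ~ collide m p1 j s).
  { intros s hs' j c; exact (no12 s hs' (mirror_collide_p1 hm c)). }
  destruct (free_motion hs (i := p1) ab free1) as [_ H1].
  specialize (H1 b ltac:(lra)); specialize (H2 b ltac:(lra)).
  rewrite va in H2.
  assert (v1 : -1 < vel (state m p1 a) < 1).
  { apply massive_subluminal; [apply (energy_neq0 hs)|].
    rewrite (proj1 (mirror_mass_outer hm a)); exact (mirror_mu_gt0 hm). }
  generalize (proj2 ca) (proj2 cb); nra. }
destruct (first_occurrence _ iso (proj1 hc0) cc0) as [c [hc [cc no1]]].
assert (ac : a < c) by lra; assert (cb' : c < b) by lra.
assert (f1 := free2 a c (Rle_refl a) (Rlt_le _ _ cb') no1).
assert (inc := free_incoming hs ac f1).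
destruct (collide23_outgoing hm cc inc) as [ec [mc vc]].
assert (pos0 : forall s, collide m p2 p3 s -> pos m p2 s = 0).
{ intros s [_ e]; generalize (proj2 (mirror_pos hm s)); lra. }
(* After [c] particle 2 moves left from the origin; the first later meeting with particle 3 would
   have to be at 0 again. *)
assert (no2 : forall s, c < s < b -> ~ collide m p2 p3 s).
{ intros s1 hs1 cs1.
  destruct (first_occurrence _ iso (proj1 hs1) cs1) as [s [[cs ss1] [css nos]]].
  assert (sb : s <= b) by lra.
  assert (f := free2 c s (Rlt_le _ _ ac) sb nos).
  generalize (proj2 (free_motion hs cs f) s ltac:(lra)).
  rewrite vc, (pos0 _ cc), (pos0 _ css); lra. }
assert (f2 := free2 c b (Rlt_le _ _ ac) (Rle_refl b) no2).
exists (state m p2 c); split; [exact (free_incoming hs cb' f2)|].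
split; [exact ec|]; split; [exact mc|].
generalize (proj2 (free_motion hs ac f1) c ltac:(lra)).
generalize (proj2 (free_motion hs cb' f2) b ltac:(lra)).
rewrite va, vc, (pos0 _ cc); lra.
Qed.

(** * The invariant product of position and kappa *)

Definition kappa_at (m : motion particle) (T : Z -> R) (n : Z) : R :=
  - 2 * en (state_after m T p2 n) / sigma_of (state_after m T p1 n).

Lemma x1_kappa_succ (mu : R) (m : motion particle) (T : Z -> R) (n : Z) :
  mirror_system mu m -> collision_times12 m T ->
  x1_at m T (n + 1) * kappa_at m T (n + 1) = x1_at m T n * kappa_at m T n.
Proof.
intros hm hT.
assert (hs := mirror_solution hm).
assert (ab := proj1 hT n).
assert (ca : collide m p1 p2 (T n)) by (apply (proj2 hT); exists n; reflexivity).
assert (cb : collide m p1 p2 (T (n + 1)%Z)).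
{ apply (proj2 hT); exists (n + 1)%Z; reflexivity. }
assert (free1 : forall s, T n < s < T (n + 1)%Z -> forall j, ~ collide m p1 j s).
{ intros s hs' j c.
  exact (no_collision12_between n hT hs' (mirror_collide_p1 hm c)). }
destruct (mirror_reflection n hm hT) as [q [hq [eq [mq xq]]]].
assert (in1 := free_incoming hs ab free1).
assert (x1 := proj2 (free_motion hs ab free1) (T (n + 1)%Z) ltac:(lra)).
destruct (collisions_resolved hs cb) as [q1 [q2 [h1 [h2 [_ [sr0 [s1 [_ [s2 _]]]]]]]]].
rewrite <- (incoming_unique hs in1 h1) in *.
rewrite <- (incoming_unique hs hq h2) in *.
destruct (collide12_outgoing hm cb) as [_ mb].
assert (mass := proj1 (mirror_mass_outer hm (T n))).
assert (mu0 := mirror_mu_gt0 hm).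
assert (e0 := energy_neq0 hs p1 (T n)).
unfold x1_at, kappa_at, state_after.
assert (xa := proj2 ca); assert (xb := proj2 cb).
rewrite <- xa, <- xb in xq; clear xa xb.
set (A := state m p1 (T n)) in *; set (e := en (state m p2 (T n))) in *.
set (t := T (n + 1)%Z) in *.
set (a := sigma_of A); set (b := rho_of A).
assert (mass' : a * b = mu)
  by (rewrite <- mass; unfold a, b, sigma_of, rho_of, mass2; ring).
assert (a0 : a <> 0) by (intros H; rewrite H in mass'; lra).
assert (b0 : b <> 0) by (intros H; rewrite H in mass'; lra).
assert (eA : en A = (a + b) / 2) by (unfold a, b, sigma_of, rho_of; lra).
assert (mA : mo A = (a - b) / 2) by (unfold a, b, sigma_of, rho_of; lra).
(* Eliminates the elapsed time between the path of particle 1, of velocity [(a - b) / (a + b)], and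
   the reflected light path [xq]. *)
assert (x' : pos m p1 t * a = pos m p1 (T n) * b).
{ assert (vA : vel A * en A = mo A) by (unfold vel; field; exact e0).
  rewrite eA, mA in vA.
  assert (X : (pos m p1 t - pos m p1 (T n)) * (a + b)
            = (t - T n) * (a - b)).
  { rewrite x1; nra. }
  nra. }
assert (es : pair_s A q = a)
  by (unfold pair_s; fold a; unfold sigma_of; rewrite eq, mq; ring).
assert (er : pair_r A q = b + 2 * e)
  by (unfold pair_r; fold b; unfold rho_of; rewrite eq, mq; ring).
rewrite es, er in *.
assert (r0 : b + 2 * e <> 0) by (intros H; apply sr0; rewrite H; ring).
assert (rq : rho_of q = 2 * e) by (unfold rho_of; lra).
rewrite rq in s2; fold b in s1.
(* As the outgoing [rho] of particle 2 is zero, the new kappa is minus the quotient of the two new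
   [sigma]. Their common factor [s / r] cancels, leaving [-2 * e / b]. *)
replace (-2 * en (state m p2 t)) with (- sigma_of (state m p2 t))
  by (unfold sigma_of; lra).
rewrite s1, s2.
apply Rmult_eq_reg_r with (a * b); [|nra].
transitivity (pos m p1 t * a * (- 2 * e)); [field; auto|].
rewrite x'; field; auto.
Qed.

Lemma x1_kappa_const (mu : R) (m : motion particle) (T : Z -> R) (n : Z) :
  mirror_system mu m -> collision_times12 m T ->
  x1_at m T n * kappa_at m T n = x1_at m T 0 * kappa_at m T 0.
Proof.
intros hm hT; induction n as [|n IH|n IH] using Z.peano_ind; [reflexivity|..].
- rewrite <- IH; exact (x1_kappa_succ n hm hT).
- rewrite <- IH, <- (x1_kappa_succ (Z.pred n) hm hT).
  now replace (Z.pred n + 1)%Z with n by lia.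
Qed.

(** * The tachyonic criterion and the bound *)

Lemma tachyonic_kappa_gt1 (mu : R) (m : motion particle) (T : Z -> R) (n : Z) :
  mirror_system mu m -> tachyonic m p1 p2 (T n) -> 1 < kappa_at m T n.
Proof.
intros hm [c [q1' [q2' [h1' [h2' neg]]]]].
assert (hs := mirror_solution hm).
destruct (collisions_resolved hs c) as [q1 [q2 [h1 [h2 [_ [sr0 [s1 [r1 [s2 r2]]]]]]]]].
rewrite (incoming_unique hs h1' h1), (incoming_unique hs h2' h2) in neg.
clear q1' q2' h1' h2'.
destruct (collide12_outgoing hm c) as [_ mb].
assert (mass := proj1 (mirror_mass_outer hm (T n))).
assert (mu0 := mirror_mu_gt0 hm).
unfold kappa_at, state_after.
set (A := state m p1 (T n)) in *; set (B := state m p2 (T n)) in *.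
assert (s0 : pair_s q1 q2 <> 0) by (intros H; apply sr0; rewrite H; ring).
assert (r0 : pair_r q1 q2 <> 0) by (intros H; apply sr0; rewrite H; ring).
(* Conservation of [s] and [r] moves the sign condition from the incoming to the outgoing states,
   where [rho_of B = 0]. *)
assert (es : sigma_of A + sigma_of B = pair_s q1 q2).
{ rewrite s1, s2; transitivity (pair_r q1 q2 * pair_s q1 q2 / pair_r q1 q2);
    [unfold pair_r at 3; field; exact r0|field; exact r0]. }
assert (er : rho_of A + rho_of B = pair_r q1 q2).
{ rewrite r1, r2; transitivity (pair_s q1 q2 * pair_r q1 q2 / pair_s q1 q2);
    [unfold pair_s at 3; field; exact s0|field; exact s0]. }
rewrite <- es, <- er in neg.
replace (rho_of B) with 0 in neg by (unfold rho_of; lra).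
replace (sigma_of B) with (2 * en B) in neg by (unfold sigma_of; lra).
assert (mass' : sigma_of A * rho_of A = mu)
  by (rewrite <- mass; unfold sigma_of, rho_of, mass2; ring).
set (a := sigma_of A) in *; set (b := rho_of A) in *.
assert (a0 : a <> 0) by (intros H; rewrite H in mass'; lra).
assert (k : -2 * en B / a * a = - 2 * en B) by (field; exact a0).
set (kap := -2 * en B / a) in *.
(* Here [s * r = (a + 2 * en B) * b = a * b * (1 - kap)]. *)
assert (mu * (1 - kap) < 0) by (rewrite <- mass'; nra).
nra.
Qed.

Theorem proposition20 (mu : R) (m : motion particle) (T : Z -> R) (n : Z)
  (hm : mirror_system mu m) (hT : collision_times12 m T)
  (hDelta : mirror_Delta mu m T >= - (calE m T)^2)
  (htach : tachyonic m p1 p2 (T n)) :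
  x1_at m T n / x1_at m T 0 <= 4 * kappa m T * (calE m T)^2 / mu.
Proof.
assert (mu0 := mirror_mu_gt0 hm).
assert (K := x1_kappa_const n hm hT).
assert (k1 := tachyonic_kappa_gt1 T n hm htach).
assert (neg : forall k, x1_at m T k < 0).
{ intros k; apply (collide12_pos_lt0 hm); apply (proj2 hT).
  exists k; reflexivity. }
assert (xn := neg n); assert (x0 := neg 0%Z).
change (kappa m T) with (kappa_at m T 0).
set (x := x1_at m T n) in *; set (y := x1_at m T 0) in *.
set (kn := kappa_at m T n) in *; set (k0 := kappa_at m T 0) in *.
assert (ratio : x / y * kn = k0).
{ transitivity (x * kn / y); [field; lra|rewrite K; field; lra]. }
assert (pos : 0 < x / y).
{ replace (x / y) with (- x / - y) by (field; lra).
  apply Rdiv_lt_0_compat; lra. }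
assert (E : mu <= 2 * calE m T ^ 2) by (unfold mirror_Delta in hDelta; lra).
(* Both factors of [k0] in [ratio] are positive; as [kn > 1], also [x / y < k0]. It then remains to
   compare [mu] with [4 * calE m T ^ 2], which [E] does. *)
assert (k00 : 0 < k0) by nra.
apply Rle_trans with k0; [nra|].
apply Rmult_le_reg_r with mu; [exact mu0|].
replace (4 * k0 * calE m T ^ 2 / mu * mu) with (4 * k0 * calE m T ^ 2)
  by (field; lra).
nra.
Qed.
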